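(* If $A$ is a bounded Wajsberg pseudo-hoop, then every type I state operator on $A$ is a type III state operator on $A$.
   Context: A pseudo-hoop is an algebra $(A,\odot,\rightarrow,\rightsquigarrow,1)$ of type $(2,2,2,0)$ such that for all $x,y,z\in A$: $x\odot 1=1\odot x=x$; $x\rightarrow x=x\rightsquigarrow x=1$; $(x\odot y)\rightarrow z=x\rightarrow(y\rightarrow z)$; $(x\odot y)\rightsquigarrow z=y\rightsquigarrow(x\rightsquigarrow z)$; $(x\rightarrow y)\odot x=(y\rightarrow x)\odot y=x\odot(x\rightsquigarrow y)=y\odot(y\rightsquigarrow x)$. The order is $x\le y$ iff $x\rightarrow y=1$; $x\wedge y=(x\rightarrow y)\odot x$. It is bounded if it has a least element $0$. Put $x\vee_1 y=(x\rightarrow y)\rightsquigarrow y$, $x\vee_2 y=(x\rightsquigarrow y)\rightarrow y$; $A$ is Wajsberg if $x\vee_1 y=y\vee_1 x$ and $x\vee_2 y=y\vee_2 x$ for all $x,y$. For $\mu:A\to A$ and all $x,y$ consider: (IS1) $\mu(x\rightarrow y)=\mu(x\vee_1 y)\rightarrow\mu(y)$ and $\mu(x\rightsquigarrow y)=\mu(x\vee_2 y)\rightsquigarrow\mu(y)$; (IS1'') $\mu(x\rightarrow y)=\mu(x)\rightarrow\mu(x\wedge y)$ and $\mu(x\rightsquigarrow y)=\mu(x)\rightsquigarrow\mu(x\wedge y)$; (IS2) $\mu(x\odot y)=\mu(x)\odot\mu(x\rightsquigarrow x\odot y)=\mu(y\rightarrow x\odot y)\odot\mu(y)$; (IS3)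 $\mu(\mu(x)\odot\mu(y))=\mu(x)\odot\mu(y)$; (IS4) $\mu(\mu(x)\rightarrow\mu(y))=\mu(x)\rightarrow\mu(y)$ and $\mu(\mu(x)\rightsquigarrow\mu(y))=\mu(x)\rightsquigarrow\mu(y)$. A type I state operator satisfies (IS1),(IS2),(IS3),(IS4); a type III state operator satisfies (IS1''),(IS2),(IS3),(IS4). *)

(* Defs.v *)
From HB Require Import structures.
From mathcomp Require Import all_boot.

Set Implicit Arguments.
Unset Strict Implicit.
Unset Printing Implicit Defensive.

Declare Scope pseudo_hoop_scope.
Delimit Scope pseudo_hoop_scope with PH.
Local Open Scope pseudo_hoop_scope.

Reserved Notation "x ~~> y" (at level 55, right associativity).

(* [imp] is the arrow and [simp] the squiggly arrow of the signature. *)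
HB.mixin Record isPseudoHoop A := {
  one : A;
  mul : A -> A -> A;
  imp : A -> A -> A;
  simp : A -> A -> A;
  mulx1 : forall x, mul x one = x;
  mul1x : forall x, mul one x = x;
  impxx : forall x, imp x x = one;
  simpxx : forall x, simp x x = one;
  imp_mul : forall x y z, imp (mul x y) z = imp x (imp y z);
  simp_mul : forall x y z, simp (mul x y) z = simp y (simp x z);
  div_impC : forall x y, mul (imp x y) x = mul (imp y x) y;
  div_imp_simp : forall x y, mul (imp y x) y = mul x (simp x y);
  div_simpC : forall x y, mul x (simp x y) = mul y (simp y x)
}.

#[short(type="pseudoHoopType")]
HB.structure Definition PseudoHoop := {A of isPseudoHoop A}.

Notation "1" := one : pseudo_hoop_scope.
Notation "x * y" := (mul x y) : pseudo_hoop_scope.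
Notation "x ==> y" := (imp x y) : pseudo_hoop_scope.
Notation "x ~~> y" := (simp x y) : pseudo_hoop_scope.

Definition ph_le (A : pseudoHoopType) (x y : A) : Prop := x ==> y = 1.

Definition meet (A : pseudoHoopType) (x y : A) : A := (x ==> y) * x.

Definition vee1 (A : pseudoHoopType) (x y : A) : A := (x ==> y) ~~> y.

Definition vee2 (A : pseudoHoopType) (x y : A) : A := (x ~~> y) ==> y.

Definition bounded (A : pseudoHoopType) : Prop :=
  exists z : A, forall x : A, ph_le z x.

Definition wajsberg (A : pseudoHoopType) : Prop :=
  (forall x y : A, vee1 x y = vee1 y x) /\
  (forall x y : A, vee2 x y = vee2 y x).

Definition IS1 (A : pseudoHoopType) (mu : A -> A) : Prop :=
  forall x y : A,
    mu (x ==> y) = mu (vee1 x y) ==> mu y /\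
    mu (x ~~> y) = mu (vee2 x y) ~~> mu y.

Definition IS1'' (A : pseudoHoopType) (mu : A -> A) : Prop :=
  forall x y : A,
    mu (x ==> y) = mu x ==> mu (meet x y) /\
    mu (x ~~> y) = mu x ~~> mu (meet x y).

Definition IS2 (A : pseudoHoopType) (mu : A -> A) : Prop :=
  forall x y : A,
    mu (x * y) = mu x * mu (x ~~> x * y) /\
    mu (x * y) = mu (y ==> x * y) * mu y.

Definition IS3 (A : pseudoHoopType) (mu : A -> A) : Prop :=
  forall x y : A, mu (mu x * mu y) = mu x * mu y.

Definition IS4 (A : pseudoHoopType) (mu : A -> A) : Prop :=
  forall x y : A,
    mu (mu x ==> mu y) = mu x ==> mu y /\
    mu (mu x ~~> mu y) = mu x ~~> mu y.

Definition type_I_state_operator (A : pseudoHoopType) (mu : A -> A) : Prop :=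
  [/\ IS1 mu, IS2 mu, IS3 mu & IS4 mu].

Definition type_III_state_operator (A : pseudoHoopType) (mu : A -> A) : Prop :=
  [/\ IS1'' mu, IS2 mu, IS3 mu & IS4 mu].

(* Main.v *)
Require Import Defs.
From HB Require Import structures.
From mathcomp Require Import all_boot.

(** Since [x ==> y = x ==> meet x y] in every pseudo-hoop, apply (IS1) to the
    pair [(x, meet x y)]: as [meet x y] lies below [x], the Wajsberg identity
    gives [vee1 x (meet x y) = vee1 (meet x y) x = 1 ~~> x = x].  The second
    half of (IS1'') is the same argument in the opposite pseudo-hoop. *)

Local Open Scope pseudo_hoop_scope.

(** The alias keeps the reversed structure, with the arrows exchanged, apart from the given one on
    the same carrier. *)
Definition opposite (A : Type) : Type := A.

Section Opposite.
Variable A : pseudoHoopType.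

HB.instance Definition _ := isPseudoHoop.Build (opposite A)
  (mul := fun x y : A => y * x) (imp := @simp A) (simp := @imp A)
  (@mul1x A) (@mulx1 A) (@simpxx A) (@impxx A)
  (fun x y z => simp_mul y x z) (fun x y z => imp_mul y x z)
  (@div_simpC A) (fun x y => esym (div_imp_simp y x)) (@div_impC A).
End Opposite.

Section PseudoHoop.
Context {A : pseudoHoopType}.
Implicit Types x y z : A.

Lemma ph_le_anti x y : ph_le x y -> ph_le y x -> x = y.
Proof.
by rewrite /ph_le => xy yx; rewrite -(mul1x x) -xy div_impC yx mul1x.
Qed.

(** By currying, both products have the same arrow into every [w]; antisymmetry concludes. *)
Lemma ph_mulA x y z : x * y * z = x * (y * z).
Proof.
have E w : (x * y * z) ==> w = (x * (y * z)) ==> w by rewrite !imp_mul.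
by apply: ph_le_anti; rewrite /ph_le ?E ?impxx // -E impxx.
Qed.

(** Let [u = 1 ==> x] and [e = x ==> 1], so [u = e * x] and [e = (e ==> 1) * e]. As [x] lies below
    [u], divisibility gives [x = (u ==> x) * u = (e ==> 1) * e * x = e * x = u]. *)
Lemma imp1x x : 1 ==> x = x.
Proof.
have le_x : x ==> (1 ==> x) = 1 by rewrite -imp_mul mulx1 impxx.
have u_def : 1 ==> x = (x ==> 1) * x by rewrite -div_impC mulx1.
have e_idem : x ==> 1 = ((x ==> 1) ==> 1) * (x ==> 1).
  by rewrite -div_impC mulx1 -imp_mul mul1x.
have x_def := div_impC x (1 ==> x).
rewrite le_x mul1x {1}u_def imp_mul impxx u_def -ph_mulA -e_idem in x_def.
by rewrite u_def -x_def.
Qed.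

Lemma impx1 x : x ==> 1 = 1.
Proof.
have x_def : (x ==> 1) * x = x by rewrite div_impC mulx1 imp1x.
by rewrite -{1}x_def imp_mul impxx.
Qed.

Lemma meetC x y : meet x y = meet y x.
Proof. exact: div_impC. Qed.

Lemma meet_lel x y : ph_le (meet x y) x.
Proof. by rewrite /ph_le /meet imp_mul impxx impx1. Qed.

(** Currying reduces one inequality to reflexivity at [meet x y], the other to [meet x (meet x y)]
    being below [y]. *)
Lemma imp_meet x y : x ==> meet x y = x ==> y.
Proof.
apply: ph_le_anti; rewrite /ph_le -imp_mul ?impxx //.
rewrite div_impC (meet_lel x y) mul1x meetC.
exact: meet_lel.
Qed.

End PseudoHoop.

Lemma simp1x {A : pseudoHoopType} (x : A) : 1 ~~> x = x.
Proof. exact: (@imp1x (opposite A : pseudoHoopType) x). Qed.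

(** Left and right divisibility agree, so the meet is self-dual. *)
Lemma opp_meet {A : pseudoHoopType} (x y : A) :
  @meet (opposite A : pseudoHoopType) x y = meet x y.
Proof. by rewrite /meet [RHS]div_impC div_imp_simp. Qed.

Lemma simp_meet {A : pseudoHoopType} (x y : A) : x ~~> meet x y = x ~~> y.
Proof.
rewrite -opp_meet.
exact: (@imp_meet (opposite A : pseudoHoopType) x y).
Qed.

Lemma vee1_meet {A : pseudoHoopType} (x y : A) :
  (forall a b : A, vee1 a b = vee1 b a) -> vee1 x (meet x y) = x.
Proof. by move=> vee1C; rewrite vee1C /vee1 (meet_lel x y) simp1x. Qed.

Lemma vee2_meet {A : pseudoHoopType} (x y : A) :
  (forall a b : A, vee2 a b = vee2 b a) -> vee2 x (meet x y) = x.
Proof.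
move=> vee2C; rewrite -opp_meet.
(* In the opposite, [vee1] is convertible to [vee2] of [A], so [vee2C] is the hypothesis needed
   there. *)
exact: (@vee1_meet (opposite A : pseudoHoopType) x y vee2C).
Qed.

Theorem theorem5p13 (A : pseudoHoopType) (hbounded : bounded A)
    (hwajsberg : wajsberg A) (mu : A -> A) :
  type_I_state_operator mu -> type_III_state_operator mu.
Proof.
case: hwajsberg => vee1C vee2C [is1 is2 is3 is4]; split=> // x y.
have [is1l is1r] := is1 x (meet x y).
by rewrite -{1}imp_meet -{1}simp_meet is1l is1r vee1_meet ?vee2_meet.
Qed.
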